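(* Let $\Delta$ be a finite set consisting of conditional domain constraints (CDCs) and X-UINDs over $R$ such that $\mathrm{cdc}(\Delta)$ is globally consistent. Then the X-UINDs are $\emptyset$-separable in $\Delta$ from the CDCs; that is, every horizontal decomposition of $R$ is lossless under $\Delta$ if and only if it is lossless under $\mathrm{cdc}(\Delta)$.
   Context: Setting. $\mathbf{dom}$ is a (possibly infinite) set of values; $\mathbf{idom}$ is a set of values from a specific interpreted domain (e.g. $\mathbb Z$) on which predicates and functions are defined according to a first-order language $\mathfrak C$ closed under negation. $R$ is a relation symbol of arity $n$ whose first $k$ positions are non-interpreted (values from $\mathbf{dom}$) and whose remaining $n-k$ positions are interpreted (values from $\mathbf{idom}$). Variables $\overline x=(x_1,\dots,x_k)$ refer to non-interpreted positions, $\overline y=(y_1,\dots,y_{n-k})$ to interpreted ones ($y_i$ refers to position $k+i$). $\mathfrak C$-formulae have free variables among $\overline y$. All instances (associating relation symbols with subsets of $\mathbf{dom}^k\times\mathbf{idom}^{n-k}$) are finite; entailment $\models$ is with respect to finite instances. $\{R(\overline t)\}$ denotes the instance whose only tuple is $\overline t$ in $R$. A CDC is a formula $\forall\overline x,\overline y.\,(R(\overline x,\overline y)\land\lambda(\overline x))\to\delta(\overline y)$, where $\lambda$ is a Boolean combination of equalities $x_i=a$ with $a\in\mathbf{dom}$ (possibly $\top$) and $\delta(\overline y)\in\mathfrak C$. $\mathrm{cdc}(\Delta)$ is the set of all CDCs in $\Delta$. A set of CDCs is globally consistent if for every $\overline t_x\in\mathbf{dom}^k$ there is $\overline t_y\in\mathbf{idom}^{n-k}$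 such that the instance $\{R(\overline t_x,\overline t_y)\}$ satisfies it. An X-UIND $R[x_i]\subseteq R[x_j]$ is a unary inclusion dependency between non-interpreted positions ($1\le i,j\le k$): it is satisfied by $I$ if every value in column $i$ of $R^I$ appears in column $j$ of $R^I$. A horizontal decomposition $\Sigma$ is a finite set of view definitions, one for each view symbol $V_1,\dots,V_m$ (each of the same arity and position types as $R$), of the form $\forall\overline x,\overline y.\,V_i(\overline x,\overline y)\leftrightarrow(R(\overline x,\overline y)\land\lambda_i(\overline x)\land\sigma_i(\overline y))$, with $\lambda_i$ a Boolean combination of equalities as for CDCs (possibly $\top$) and $\sigma_i\in\mathfrak C$; the conjunct $\sigma_i$ may be absent. $\Sigma$ is lossless under a set $\Gamma$ of constraints over $R$ if $\Gamma\cup\Sigma\models\forall\overline x,\overline y.\,R(\overline x,\overline y)\leftrightarrow\bigvee_iV_i(\overline x,\overline y)$. Separability: for a finite set $\mathcal S$ of sound inference rules, the constraints in $\Delta$ other than CDCs are $\mathcal S$-separable in $\Delta$ from the CDCs if every horizontal decomposition is lossless under $\Delta$ exactly when it is lossless under $\mathrm{cdc}(\Delta^* )$, with $\Delta^*$ the closure of $\Delta$ under $\mathcal S$ (so $\Delta^*=\Delta$ for $\mathcal S=\emptyset$). *)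

(* Defs.v *)
From mathcomp Require Import all_boot.
From mathcomp Require Import boolp classical_sets functions cardinality.
From Stdlib Require List.

Set Implicit Arguments.
Unset Strict Implicit.
Unset Printing Implicit Defensive.

Local Open Scope classical_set_scope.

Record signature := Signature {
  fsym : Type;
  farity : fsym -> nat;
  psym : Type;
  parity : psym -> nat }.

Inductive term (S : signature) (m : nat) : Type :=
| Var of 'I_m
| App (f : fsym S) of ('I_(farity f) -> term S m).

(* [formula S m] is the type of first-order formulae over [S] whose free
   variables are among m variables; a quantifier binds the variable [ord0] of
   its body and shifts the other ones by one. *)
Inductive formula (S : signature) : nat -> Type :=
| FTrue m : formula S m
| FEq m of term S m & term S m : formula S m
| FPred m (p : psym S) of ('I_(parity p) -> term S m) : formula S m
| FNot m of formula S m : formula S m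
| FAnd m of formula S m & formula S m : formula S m
| FOr m of formula S m & formula S m : formula S m
| FAll m of formula S m.+1 : formula S m
| FEx m of formula S m.+1 : formula S m.

Record interpretation (S : signature) (D : Type) := Interpretation {
  finterp : forall f : fsym S, ('I_(farity f) -> D) -> D;
  pinterp : forall p : psym S, ('I_(parity p) -> D) -> Prop }.

Definition extend_val (D : Type) (m : nat) (d : D) (v : 'I_m -> D) :
    'I_m.+1 -> D :=
  fun i => if unlift ord0 i is Some j then v j else d.

Fixpoint eval_term (S : signature) (D : Type) (J : interpretation S D)
    (m : nat) (v : 'I_m -> D) (t : term S m) : D :=
  match t with
  | Var i => v i
  | App f args => finterp J (fun i => eval_term J v (args i))
  end.

Fixpoint holds (S : signature) (D : Type) (J : interpretation S D)
    (m : nat) (phi : formula S m) : ('I_m -> D) -> Prop :=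
  match phi in formula _ m return ('I_m -> D) -> Prop with
  | FTrue _ => fun _ => True
  | FEq _ t u => fun v => eval_term J v t = eval_term J v u
  | FPred _ p args => fun v => pinterp J (fun i => eval_term J v (args i))
  | FNot _ phi1 => fun v => ~ holds J phi1 v
  | FAnd _ phi1 phi2 => fun v => holds J phi1 v /\ holds J phi2 v
  | FOr _ phi1 phi2 => fun v => holds J phi1 v \/ holds J phi2 v
  | FAll _ phi1 => fun v => forall d : D, holds J phi1 (extend_val d v)
  | FEx _ phi1 => fun v => exists d : D, holds J phi1 (extend_val d v)
  end.

(* The set of formulae over the interpreted positions that may be used in
   constraints and views; it can be any fragment of first-order logic.  Closure
   under negation is up to equivalence over the interpreted domain, so that
   [~ (y <= c)] may be represented by [c + 1 <= y] over the integers. *)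
Record language (S : signature) (idom : Type) (J : interpretation S idom)
    (m : nat) := Language {
  in_language : set (formula S m);
  language_neg : forall phi, in_language phi ->
    exists2 psi, in_language psi & forall v, holds J psi v <-> ~ holds J phi v }.

Record cformula (S : signature) (idom : Type) (J : interpretation S idom)
    (m : nat) (C : language J m) := CFormula {
  cform : formula S m;
  cformP : in_language C cform }.

Definition sat_cformula (S : signature) (idom : Type)
    (J : interpretation S idom) (m : nat) (C : language J m)
    (delta : cformula C) (y : m.-tuple idom) : Prop :=
  holds J (cform delta) (tnth y).

Inductive xcond (dom : Type) (k : nat) : Type :=
| XTop
| XEq of 'I_k & dom
| XNot of xcond dom k
| XAnd of xcond dom k & xcond dom k
| XOr of xcond dom k & xcond dom k.

Fixpoint sat_xcond (dom : Type) (k : nat) (x : k.-tuple dom)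
    (l : xcond dom k) : Prop :=
  match l with
  | XTop => True
  | XEq i a => tnth x i = a
  | XNot l1 => ~ sat_xcond x l1
  | XAnd l1 l2 => sat_xcond x l1 /\ sat_xcond x l2
  | XOr l1 l2 => sat_xcond x l1 \/ sat_xcond x l2
  end.

(* A relation with k non-interpreted and m interpreted positions. *)
Definition relation_on (dom idom : Type) (k m : nat) : Type :=
  set (k.-tuple dom * m.-tuple idom).

(* [CDC l delta] is  forall x y, R(x,y) /\ l(x) -> delta(y);
   [XUIND i j] is  R[x_i] <= R[x_j]. *)
Inductive constraint (dom : Type) (k : nat) (S : signature) (idom : Type)
    (J : interpretation S idom) (m : nat) (C : language J m) : Type :=
| CDC of xcond dom k & cformula C
| XUIND of 'I_k & 'I_k.

Section Constraints.
Variables (dom : Type) (k : nat) (S : signature) (idom : Type).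
Variables (J : interpretation S idom) (m : nat) (C : language J m).

Implicit Types (R : relation_on dom idom k m) (c : constraint dom k C).
Implicit Types (Gamma Delta : set (constraint dom k C)).

Definition sat_constraint R c : Prop :=
  match c with
  | CDC l delta =>
      forall x y, R (x, y) /\ sat_xcond x l -> sat_cformula delta y
  | XUIND i j =>
      [set tnth t.1 i | t in R] `<=` [set tnth t.1 j | t in R]
  end.

Definition sat R Gamma : Prop := forall c, Gamma c -> sat_constraint R c.

Definition is_cdc c : Prop := if c is CDC _ _ then True else False.

Definition cdc Delta : set (constraint dom k C) := Delta `&` is_cdc.

Definition globally_consistent Gamma : Prop :=
  forall tx : k.-tuple dom, exists ty : m.-tuple idom, sat [set (tx, ty)] Gamma.

(* The view  V(x,y) <-> R(x,y) /\ l(x) /\ s(y), where s may be absent. *)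
Record view_def := ViewDef {
  view_lambda : xcond dom k;
  view_sigma : option (cformula C) }.

Definition sat_view_def (V R : relation_on dom idom k m) (d : view_def) : Prop :=
  forall x y, V (x, y) <->
    [/\ R (x, y), sat_xcond x (view_lambda d)
      & if view_sigma d is Some s then sat_cformula s y else True].

Record decomposition := Decomposition {
  nviews : nat;
  views : 'I_nviews -> view_def }.

(* The entailment is over the finite instances of R and the view symbols. *)
Definition lossless Gamma (Sigma : decomposition) : Prop :=
  forall R (V : 'I_(nviews Sigma) -> relation_on dom idom k m),
    finite_set R -> (forall i, finite_set (V i)) ->
    sat R Gamma -> (forall i, sat_view_def (V i) R (views i)) ->
    forall x y, R (x, y) <-> exists i, V i (x, y).

(* An inference rule, given by its instances: [r prems c] when [r] derives [c]
   from the constraints in [prems]. *)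
Definition inference_rule : Type :=
  seq (constraint dom k C) -> constraint dom k C -> Prop.

Definition sound (r : inference_rule) : Prop :=
  forall prems c, r prems c ->
  forall R, finite_set R ->
    (forall d, List.In d prems -> sat_constraint R d) -> sat_constraint R c.

Inductive rule_closure (rules : set inference_rule) Delta :
    constraint dom k C -> Prop :=
| closure_base c : Delta c -> rule_closure rules Delta c
| closure_step r prems c : rules r -> r prems c ->
    (forall d, List.In d prems -> rule_closure rules Delta d) ->
    rule_closure rules Delta c.

(* The constraints of [Delta] other than CDCs are [rules]-separable in [Delta]
   from the CDCs. *)
Definition separable (rules : set inference_rule) Delta : Prop :=
  [/\ finite_set rules, (forall r, rules r -> sound r)
    & forall Sigma : decomposition,
        lossless Delta Sigma <->
        lossless (cdc (rule_closure rules Delta)) Sigma].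

End Constraints.

(* Main.v *)
Require Import Defs.
From mathcomp Require Import all_boot.
From mathcomp Require Import boolp classical_sets functions cardinality.

(* The only direction with content turns a counterexample to losslessness under
   the CDCs into one under all constraints.  Both the CDCs and the membership in
   a view concern a single tuple, so a tuple (x, y) missed by all views may be
   kept alone.  For each value a of x, global consistency gives interpreted
   values for the constant tuple (a, ..., a); adding these finitely many tuples
   to (x, y) makes every non-interpreted column equal to the set of values of x,
   so that all X-UINDs hold. *)

Local Open Scope classical_set_scope.

Section Separability.
Set Implicit Arguments.
Unset Strict Implicit.
Variables (dom idom : Type) (k m : nat) (S : signature).
Variables (J : interpretation S idom) (C : language J m).
Implicit Types (Gamma Delta : set (constraint dom k C)).
Implicit Types (R : relation_on dom idom k m).

(** A CDC quantifies over a single tuple, so models of the CDCs can be cut down to one tuple or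
    glued together freely. *)
Lemma sat_cdc_tuplewise R Delta :
  sat R (cdc Delta) <-> (forall t, R t -> sat [set t] (cdc Delta)).
Proof.
split=> [satR [x y] Rxy [l delta|i j] Dc|satR [l delta|i j] Dc].
- by move=> _ _ [[-> ->] lx]; exact: (satR _ Dc x y (conj Rxy lx)).
- by case: Dc.
- by move=> x y [Rxy lx]; exact: (satR _ Rxy _ Dc x y (conj erefl lx)).
- by case: Dc.
Qed.

Lemma rule_closure_set0 Delta : rule_closure set0 Delta = Delta.
Proof.
apply/seteqP; split=> c; last exact: closure_base.
by elim=> // r prems d [].
Qed.

Lemma lossless_sub Gamma Delta (Sigma : decomposition dom k C) :
  Gamma `<=` Delta -> lossless Gamma Sigma -> lossless Delta Sigma.
Proof.
move=> sGD GS R V finR finV satR; apply: GS => // c Gc.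
exact/satR/sGD.
Qed.

Lemma globally_consistent_completion Delta (x : k.-tuple dom)
    (y : m.-tuple idom) :
  globally_consistent (cdc Delta) -> sat [set (x, y)] (cdc Delta) ->
  exists R, [/\ finite_set R, R (x, y) & sat R Delta].
Proof.
move=> /choice[f fP] satxy.
(* Indexing by positions of [x] instead of values makes [range g] finite at once; repeated values do
   no harm. *)
pose g (i : 'I_k) := (nseq_tuple k (tnth x i), f (nseq_tuple k (tnth x i))).
exists ([set (x, y)] `|` range g); split; [|by left|].
  by rewrite finite_setU; split; [exact: finite_set1|exact: finite_image].
have satR : sat ([set (x, y)] `|` range g) (cdc Delta).
  by apply/sat_cdc_tuplewise => t [->//|[i _ <-]]; exact: fP.
have gE i j : tnth (g i).1 j = tnth x i.
  by rewrite (tnth_nth (tnth x i)) /= nth_nseq ltn_ord.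
case=> [l delta|i j] Dc; first exact: (satR (CDC l delta)).
have xj l : [set tnth t.1 j | t in [set (x, y)] `|` range g] (tnth x l).
  by exists (g l); [right; exists l|exact: gE].
(* Column [i] contains only values of [x], and by [xj] column [j] contains them all. *)
by move=> _ [t [->|[l _ <-]] <-]; rewrite ?gE; exact: xj.
Qed.

Lemma lossless_cdc Delta (Sigma : decomposition dom k C) :
  globally_consistent (cdc Delta) ->
  lossless Delta Sigma <-> lossless (cdc Delta) Sigma.
Proof.
move=> cons; split; last by apply: lossless_sub => c [].
move=> DS R V _ _ /sat_cdc_tuplewise satR VE x y.
split=> [Rxy|[i /VE[]//]].
have [R' [finR' R'xy satR']] :=
  globally_consistent_completion cons (satR _ Rxy).
pose V' (i : 'I_(nviews Sigma)) : relation_on dom idom k m := [set t | [/\ R' t,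
  sat_xcond t.1 (view_lambda (views i))
  & if view_sigma (views i) is Some s then sat_cformula s t.2 else True]].
have finV' i : finite_set (V' i).
  by apply: sub_finite_set finR' => t [].
have V'E i : sat_view_def (V' i) R' (views i) by [].
have [i [_ lx sy]] := (DS R' V' finR' finV' satR' V'E x y).1 R'xy.
(* The conditions of view [i] on [(x, y)] do not mention the rest of the instance, so they carry
   over from [R'] to [R]. *)
by exists i; apply/VE.
Qed.

End Separability.

Theorem theorem8
  (dom idom : Type) (n k : nat) (hkn : (k <= n)%N)
  (S : signature) (J : interpretation S idom) (C : language J (n - k))
  (Delta : set (constraint dom k C))
  (hfin : finite_set Delta)
  (hcons : globally_consistent (cdc Delta)) :
  separable set0 Delta /\
  (forall Sigma : decomposition dom k C,
     lossless Delta Sigma <-> lossless (cdc Delta) Sigma).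
Proof.
have cdcP Sigma := lossless_cdc Sigma hcons.
by split=> //; split; rewrite ?rule_closure_set0.
Qed.
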